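(* Let $n = 2^l \cdot m$, where $l \geq 0$ is an integer and $m$ is a positive odd integer, and let $q = 2^n$. Let $C_{q^2+1}$ be the cyclic subgroup of order $q^2+1$ of $\mathbb{F}_{q^4}^*$, let $H := C_{q^2+1} \setminus \{1\}$, and let $H_1, H_2 \subseteq H$ be the subsets defined in the context. (1) If $\gamma \in H_1$, then $\mathrm{Tr}_n(\theta^2(\gamma)) = \mathrm{Tr}_n((\theta^2(\gamma))^{-1}) = 1$, while $\mathrm{Tr}_n(\theta^i(\gamma)) = \mathrm{Tr}_n((\theta^i(\gamma))^{-1}) = 0$ for all integers $i \geq 3$. (2) If $\gamma \in H_2$, then $\mathrm{Tr}_n(\theta^{l+3}(\gamma)) = 0$ and $\mathrm{Tr}_n((\theta^{l+3}(\gamma))^{-1}) = 1$. Moreover $\mathrm{Tr}_n(\theta^i(\gamma)) = 1$ and $\mathrm{Tr}_n((\theta^i(\gamma))^{-1}) = 0$ for all integers $i \geq l+4$.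
   Context: For a finite field $F$ of characteristic $2$, the map $\theta$ on $\mathbf{P}^1(F) = F \cup \{\infty\}$ is defined by $\theta(0) = \theta(\infty) = \infty$ and $\theta(x) = x + x^{-1}$ for $x \in F \setminus \{0\}$ (compatibly with field extensions). $\theta^i$ denotes the $i$-fold composition of $\theta$ with itself. For a nonzero field element $x$, $|x|$ is its multiplicative order. For $x \in \mathbb{F}_{2^n}$, $\mathrm{Tr}_n(x) = \sum_{j=0}^{n-1} x^{2^j} \in \mathbb{F}_2$ is the absolute trace. Conventions: $0^{-1} = 0$, $\infty^{-1} = \infty$, $|0| = |\infty| = 1$, $\mathrm{Tr}_n(\infty) = 0$. The subsets of $H$ are defined as follows. $\gamma \in H$ belongs to $H_1$ if and only if $|\theta(\gamma)|$ divides $q+1$ and $|\theta^i(\gamma)|$ divides $q-1$ for all integers $i \geq 2$. $\gamma \in H$ belongs to $H_2$ if and only if: (a) for every integer $i$ with $1 \leq i \leq l+1$ there are integers $d_i, e_i > 1$ with $d_i \mid (q+1)$, $e_i \mid (q-1)$ and $|\theta^i(\gamma)| = d_i e_i$; (b) $|\theta^{l+2}(\gamma)|$ divides $q+1$; (c) $|\theta^i(\gamma)|$ divides $q-1$ for all integers $i \geq l+3$. In both cases the iterates whose traces $\mathrm{Tr}_n$ are considered in the claim lie in $\mathbf{P}^1(\mathbb{F}_q)$. *)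

(* Defs.v *)
From HB Require Import structures.
From mathcomp Require Import all_boot all_order all_algebra all_fingroup.

Set Implicit Arguments.
Unset Strict Implicit.
Unset Printing Implicit Defensive.

Import GRing.Theory.
Local Open Scope ring_scope.

(* The projective line over F: [Some x] is the point x of F, [None] is the    *)
(* point at infinity.                                                         *)
Definition P1 (F : Type) : Type := option F.

Section Theta.

Variable F : finFieldType.
Implicit Type x : P1 F.

Definition theta x : P1 F :=
  if x is Some y then (if y == 0 then None else Some (y + y^-1)) else None.

(* On F this is the inverse of the field, for which 0^-1 = 0.                 *)
Definition P1inv x : P1 F := omap (@GRing.inv F) x.

(* [insub] fails exactly on 0, so the order of both 0 and infinity is 1.      *)
Definition P1order x : nat :=
  if x is Some y then
    (if insub y is Some u then #[u : {unit F}]%g else 1%N)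
  else 1%N.

(* The absolute trace of F_(2^n), written as an element of the ambient field  *)
(* F: on the subfield F_(2^n) it takes the values 0 and 1.                    *)
Definition P1tr (n : nat) x : F :=
  if x is Some y then \sum_(j < n) y ^+ (2 ^ j) else 0.

Definition in_H (C : {set {unit F}}) (g : {unit F}) : Prop :=
  g \in C :\ 1%g.

Definition theta_iter (i : nat) (g : {unit F}) : P1 F :=
  iter i theta (Some (val g)).

Definition in_H1 (q : nat) (C : {set {unit F}}) (g : {unit F}) : Prop :=
  [/\ in_H C g,
      (P1order (theta_iter 1 g) %| q + 1)%N &
      forall i : nat, (2 <= i)%N -> (P1order (theta_iter i g) %| q - 1)%N].

Definition in_H2 (l q : nat) (C : {set {unit F}}) (g : {unit F}) : Prop :=
  [/\ in_H C g,
      forall i : nat, (1 <= i <= l + 1)%N ->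
        exists d e : nat,
          [/\ (1 < d)%N, (1 < e)%N, (d %| q + 1)%N, (e %| q - 1)%N &
              P1order (theta_iter i g) = (d * e)%N],
      (P1order (theta_iter (l + 2) g) %| q + 1)%N &
      forall i : nat, (l + 3 <= i)%N ->
        (P1order (theta_iter i g) %| q - 1)%N].

End Theta.

(* Main.v *)
Require Import Defs.
From HB Require Import structures.
From mathcomp Require Import all_boot all_order all_algebra all_fingroup all_solvable.
From mathcomp Require Import finfield.

Set Implicit Arguments.
Unset Strict Implicit.
Unset Printing Implicit Defensive.

Import GRing.Theory.
Local Open Scope ring_scope.

(**
  For b = x + 1/x nonzero, the element y = x/b satisfies y^2 + y = 1/b^2, so the
  sum defining Tr_n(1/b)^2 telescopes to y^q + y. This is 0 if x^q = x and 1 if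
  x^q = 1/x. Hence Tr_n(1/theta(x)) vanishes on P^1(F_q), where moreover
  Tr_n(theta(x)) = Tr_n(x) + Tr_n(1/x); so both traces are determined along an
  orbit by their values at its first point b in P^1(F_q). That point is
  b = a + 1/a with a^(q+1) = 1, so Tr_n(1/b) = 1, and Tr_n(b) = Tr_2n(1/a). Here
  a = theta(x), where x = gamma satisfies x^(q^2) = 1/x for gamma in H_1,
  whereas x = theta^(l+1)(gamma) lies in F_(q^2) for gamma in H_2; the same
  computation over F_(q^2) gives Tr_2n(1/a) = 1 and 0 respectively.
*)

Section Trace.

Variable F : finFieldType.
Hypothesis charF2 : 2%N \in [pchar F].
Implicit Types (x y a : F) (n k : nat).

Definition tr n x : F := \sum_(j < n) x ^+ (2 ^ j).

Lemma exprD_pow2 k x y : (x + y) ^+ (2 ^ k) = x ^+ (2 ^ k) + y ^+ (2 ^ k).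
Proof.
apply: exprDn_pchar; apply: (sub_in_pnat (pi := 2%N)); last by rewrite pnatX.
by move=> p _ /eqP ->.
Qed.

Lemma trD n x y : tr n (x + y) = tr n x + tr n y.
Proof. by rewrite -big_split; apply: eq_bigr => j _; apply: exprD_pow2. Qed.

Lemma tr0 n : tr n 0 = 0.
Proof. by apply: big1 => j _; rewrite expr0n expn_eq0. Qed.

Lemma tr_sqr n x : tr n (x ^+ 2) = tr n x ^+ 2.
Proof.
rewrite /tr; elim: n => [|n IHn]; first by rewrite !big_ord0 expr0n.
by rewrite !big_ord_recr /= IHn (exprD_pow2 1) exprAC.
Qed.

Lemma tr_telescope n y : tr n (y ^+ 2 + y) = y ^+ (2 ^ n) + y.
Proof.
rewrite /tr; elim: n => [|n IHn]; first by rewrite big_ord0 addrr_pchar2.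
rewrite big_ord_recr /= IHn exprD_pow2 -exprM -expnS addrC.
by rewrite -addrA (addrA (y ^+ (2 ^ n))) addrr_pchar2 // add0r.
Qed.

(** Transitivity of the trace: [x + x ^+ (2 ^ n)] is the relative trace from F_(q^2) to F_q. *)
Lemma tr_double n x : tr (n * 2) x = tr n (x + x ^+ (2 ^ n)).
Proof.
rewrite trD /tr muln2 -addnn big_split_ord /=; congr (_ + _).
by apply: eq_bigr => j _; rewrite -exprM -expnD.
Qed.

(** Multiplying by x gives x^2 + 1, which is (x + 1)^2 in characteristic 2. *)
Lemma addrV_eq0 x : x != 0 -> x + x^-1 = 0 -> x = 1.
Proof.
move=> x0 /(congr1 (fun z => z * x)); rewrite mul0r mulrDl mulVf // -expr2.
rewrite -[X in _ + X](expr1n _ 2) -(exprD_pow2 1) => /eqP.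
by rewrite expf_eq0 /= addr_eq0 oppr_pchar2 // => /eqP.
Qed.

Lemma tr_inv_addrV n x : x != 0 -> x + x^-1 != 0 ->
  tr n (x + x^-1)^-1 ^+ 2 = (x / (x + x^-1)) ^+ (2 ^ n) + x / (x + x^-1).
Proof.
move=> x0 b0; rewrite -tr_sqr -tr_telescope; congr (tr n _).
set b := x + x^-1 in b0 *.
(* Over the denominator [b ^+ 2], adding (x / b)^2 leaves only 1 / b^2. *)
have xb : x / b = (x ^+ 2 + 1) / b ^+ 2.
  have -> : x ^+ 2 + 1 = x * b by rewrite mulrDr divff.
  by rewrite (expr2 b) invfM mulrA mulfK.
rewrite [X in _ + X]xb expr_div_n -mulrDl addrA addrr_pchar2 //.
by rewrite add0r mul1r exprVn.
Qed.

Lemma addrV_fixed n x : x ^+ (2 ^ n) = x \/ x ^+ (2 ^ n) = x^-1 ->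
  (x + x^-1) ^+ (2 ^ n) = x + x^-1.
Proof. by rewrite exprD_pow2 exprVn => -[] ->; rewrite // invrK addrC. Qed.

Lemma tr_inv_addrV_fixed n x : x ^+ (2 ^ n) = x -> tr n (x + x^-1)^-1 = 0.
Proof.
(* Since 0^-1 = 0, the cases x = 0 and x + 1/x = 0 reduce to the trace of 0. *)
move=> xq; have [->|x0] := eqVneq x 0; first by rewrite invr0 addr0 invr0 tr0.
have [->|b0] := eqVneq (x + x^-1) 0; first by rewrite invr0 tr0.
apply/eqP; rewrite -[_ == 0](expf_eq0 _ 2) tr_inv_addrV // expr_div_n xq.
by rewrite addrV_fixed ?addrr_pchar2 //; left.
Qed.

Lemma tr_inv_addrV_unitary n x :
  x != 0 -> x != 1 -> x ^+ (2 ^ n) = x^-1 -> tr n (x + x^-1)^-1 = 1.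
Proof.
move=> x0 x1 xq.
have b0 : x + x^-1 != 0 by apply: contra x1 => /eqP/addrV_eq0 ->.
(* The squared trace is (x^q + x) / b = (1/x + x) / b = 1, and squaring is injective. *)
have /eqP : (tr n (x + x^-1)^-1 + 1) ^+ 2 = 0.
  rewrite (exprD_pow2 1) expr1n tr_inv_addrV // expr_div_n xq.
  rewrite addrV_fixed; last by right.
  by rewrite -mulrDl [x^-1 + x]addrC divff ?addrr_pchar2.
by rewrite expf_eq0 /= addr_eq0 oppr_pchar2 // => /eqP.
Qed.

Lemma tr_addrV_unitary n x :
  x ^+ (2 ^ n) = x^-1 -> tr n (x + x^-1) = tr (n * 2) x^-1.
Proof. by move=> xq; rewrite tr_double exprVn xq invrK addrC. Qed.

(** The points of P^1(F_q), q = 2^n, described inside P^1(F) as the fixed points of Frobenius. *)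
Definition P1fixed n (x : P1 F) : Prop :=
  if x is Some y then y ^+ (2 ^ n) = y else True.

Lemma P1fixed_theta n (x : P1 F) : P1fixed n x -> P1fixed n (theta x).
Proof.
case: x => [x|] //= xq; case: eqP => // _.
by apply: addrV_fixed; left.
Qed.

Lemma P1tr_theta n (x : P1 F) :
  P1tr n (theta x) = P1tr n x + P1tr n (P1inv x).
Proof.
case: x => [x|] /=; last by rewrite addr0.
case: eqP => [->|_] /=; last exact: trD.
by rewrite invr0 -[\sum_(_ < _) _]/(tr n 0) tr0 addr0.
Qed.

Lemma P1tr_inv_theta n (x : P1 F) :
  P1fixed n x -> P1tr n (P1inv (theta x)) = 0.
Proof.
by case: x => [x|] //= xq; case: eqP => // _; apply: tr_inv_addrV_fixed.
Qed.

(** From the first image on, the inverse has trace 0, so by [P1tr_theta] the trace no longer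
    changes. *)
Lemma P1tr_orbit n (x : P1 F) k : P1fixed n x ->
  P1tr n (iter k.+1 (@theta F) x) = P1tr n x + P1tr n (P1inv x) /\
  P1tr n (P1inv (iter k.+1 (@theta F) x)) = 0.
Proof.
move=> xq.
have fixk j : P1fixed n (iter j (@theta F) x).
  by elim: j => //= j IHj; apply: P1fixed_theta.
have invk j : P1tr n (P1inv (iter j.+1 (@theta F) x)) = 0.
  by rewrite iterS; apply: P1tr_inv_theta.
split=> //; elim: k => [|k IHk]; first by rewrite /= P1tr_theta.
by rewrite iterS P1tr_theta IHk invk addr0.
Qed.

(** The step at which an orbit enters P^1(F_q): here a^q = 1/a differs from a. *)
Lemma theta_unitary n a :
  a != 0 -> a != 1 -> (P1order (Some a) %| 2 ^ n + 1)%N ->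
  [/\ P1fixed n (theta (Some a)),
      P1tr n (theta (Some a)) = tr (n * 2) a^-1 &
      P1tr n (P1inv (theta (Some a))) = 1].
Proof.
move=> a0 a1 ord_a.
have aq : a ^+ (2 ^ n) = a^-1.
  apply: (mulIf a0); rewrite mulVf // -exprSr -addn1.
  move: ord_a; rewrite /P1order.
  case: insubP => [u _ <-|]; last by rewrite unitfE a0.
  by rewrite order_dvdn -FinRing.val_unitX => /eqP ->.
rewrite /= (negPf a0); split.
- by apply: addrV_fixed; right.
- exact: tr_addrV_unitary.
- exact: tr_inv_addrV_unitary.
Qed.

(** The equation reads x^2 = x + 1, so x^3 = x^2 + x = 1. It serves to exclude a = 1 in
    [theta_unitary]. *)
Lemma addrV_eq1_expr3 x : x != 0 -> x + x^-1 = 1 -> x ^+ 3 = 1.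
Proof.
move=> x0 /(congr1 (fun z => z * x)); rewrite mulrDl mulVf // mul1r => e.
have x2 : x * x = x + 1 by rewrite -[in RHS]e -addrA addrr_pchar2 ?addr0.
by rewrite !exprS expr0 mulr1 x2 mulrDr mulr1 x2 addrAC addrr_pchar2 ?add0r.
Qed.

End Trace.

(** A product of two such factors is at least 4. Hence a point of order [d * e] is not 0, infinity
    or a cube root of unity. *)
Lemma muln_ndvd3 d e : (1 < d)%N -> (1 < e)%N -> ~~ (d * e %| 3)%N.
Proof.
move=> d1 e1; apply: contraL (leq_mul d1 e1) => /dvdn_leq; rewrite -ltnNge.
by apply.
Qed.

Lemma P1order_dvd_expr (F : finFieldType) (x : F) k :
  x != 0 -> x ^+ k = 1 -> (P1order (Some x) %| k)%N.
Proof.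
move=> x0 xk; rewrite /P1order.
case: insubP => [u _ ux|]; last by rewrite unitfE x0.
by rewrite order_dvdn; apply/eqP/val_inj; rewrite FinRing.val_unitX /= ux.
Qed.

Theorem corollary4p4 (l m n q : nat) (F : finFieldType)
    (C : {group {unit F}})
    (hm : odd m) (hn : n = (2 ^ l * m)%N) (hq : q = (2 ^ n)%N)
    (hF : #|F| = (q ^ 4)%N)
    (hCcyclic : cyclic C) (hCcard : #|C| = (q ^ 2 + 1)%N) :
  (forall g : {unit F}, in_H1 q C g ->
     [/\ P1tr n (theta_iter 2 g) = 1,
         P1tr n (P1inv (theta_iter 2 g)) = 1 &
         forall i : nat, (3 <= i)%N ->
           P1tr n (theta_iter i g) = 0 /\
           P1tr n (P1inv (theta_iter i g)) = 0]) /\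
  (forall g : {unit F}, in_H2 l q C g ->
     [/\ P1tr n (theta_iter (l + 3) g) = 0,
         P1tr n (P1inv (theta_iter (l + 3) g)) = 1 &
         forall i : nat, (l + 4 <= i)%N ->
           P1tr n (theta_iter i g) = 1 /\
           P1tr n (P1inv (theta_iter i g)) = 0]).
Proof.
have charF2 : 2%N \in [pchar F].
  by apply: (card_finPcharP (n := (n * 4)%N)); rewrite // hF hq -expnM.
have q2E : (2 ^ (n * 2) = q ^ 2)%N by rewrite expnM hq.
have HP g : in_H C g ->
    [/\ val g != 0, val g != 1 & val g ^+ (2 ^ (n * 2)) = (val g)^-1].
  rewrite /in_H !inE => /andP[g1 gC]; have g0 : val g != 0.
    by rewrite -unitfE; apply: valP.
  have /eqP gC1 : (g ^+ #|C| == 1)%g by rewrite -order_dvdn order_dvdG.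
  split=> //; apply: (mulIf g0); rewrite mulVf // -exprSr q2E.
  by rewrite -(addn1 (q ^ 2)) -hCcard -FinRing.val_unitX gC1.
have orbitP i j g : (i < j)%N ->
    theta_iter j g = iter (j - i.+1).+1 (@theta F) (theta_iter i g).
  by move=> ij; rewrite /theta_iter -iterD -subSn // subSS subnK // ltnW.
split=> g.
  case=> /HP[g0 g1 gq] ord1 _.
  have b0 : val g + (val g)^-1 != 0.
    by apply: contra g1 => /eqP/(addrV_eq0 charF2) ->.
  have E1 : theta_iter 1 g = Some (val g + (val g)^-1).
    by rewrite /theta_iter /= (negPf g0).
  (* Otherwise the order of g divides gcd(3, q^2 + 1) = 1. *)
  have b1 : val g + (val g)^-1 != 1.
    apply: contra g1 => /eqP/(addrV_eq1_expr3 charF2 g0) g3.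
    have : val g ^+ (q ^ 2 + 1) = 1 by rewrite addn1 exprSr -q2E gq mulVf.
    (* As q^2 = 4^n is 1 modulo 3, the exponent q^2 + 1 is 2 modulo 3. *)
    have -> : (q ^ 2 + 1 = 3 * ((q ^ 2).-1 %/ 3) + 2)%N.
      have: (4 ^ n = 1 %[mod 3])%N by rewrite -modnXm exp1n.
      have -> : (q ^ 2 = 4 ^ n)%N by rewrite hq -expnM mulnC expnM.
      have: (0 < 4 ^ n)%N by rewrite expn_gt0.
      case: (4 ^ n)%N => //= k _ /eqP; rewrite eqn_mod_dvd // subn1 /= => k3.
      by rewrite mulnC divnK // addn1 addn2.
    rewrite exprD exprM g3 expr1n mul1r => g2.
    by move: g3; rewrite exprS g2 mulr1 => ->.
  have [] := theta_unitary charF2 (n := n) b0 b1; first by rewrite -E1 -hq.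
  (* Taken over F_(q^2), where [gq] makes [val g] unitary: Tr_2n(1/a) = 1 for a = theta(g). *)
  rewrite -E1 -[theta _]/(theta_iter 2 g) tr_inv_addrV_unitary // => fx t1 t2.
  split=> // i i3; rewrite (orbitP 2%N i g i3).
  by have := P1tr_orbit charF2 (i - 3) fx; rewrite t1 t2 addrr_pchar2.
case=> /HP[g0 g1 gq] ord ord2 _.
(* The orbit lies in P^1(F_(q^2)) from its first image on, because g^(q^2) = 1/g. *)
have fix1 j : P1fixed (n * 2) (theta_iter j.+1 g).
  elim: j => [|j IHj]; last exact: P1fixed_theta.
  by rewrite /theta_iter /= (negPf g0); apply: addrV_fixed => //; right.
have /ord[d [e [d1 e1 _ _ ordx]]] : (1 <= l + 1 <= l + 1)%N.
  by rewrite addn1 leqnn.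
have [x Ex] : exists x, theta_iter (l + 1) g = Some x.
  case: theta_iter ordx => [x|] /= ordx; first by exists x.
  by have := muln_ndvd3 d1 e1; rewrite -ordx.
have xq : x ^+ (2 ^ (n * 2)) = x by have := fix1 l; rewrite -(addn1 l) Ex.
rewrite Ex in ordx.
have x0 : x != 0.
  apply/eqP => xE; move: ordx; rewrite xE /P1order insubF ?unitr0 // => ordx.
  by have := muln_ndvd3 d1 e1; rewrite -ordx.
have no3 : x ^+ 3 <> 1.
  by move=> /(P1order_dvd_expr x0); apply/negP; rewrite ordx muln_ndvd3.
have b0 : x + x^-1 != 0.
  by apply/eqP => /(addrV_eq0 charF2 x0) xE; apply: no3; rewrite xE expr1n.
have b1 : x + x^-1 != 1.
  by apply/eqP => /(addrV_eq1_expr3 charF2 x0).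
have E2 : theta_iter (l + 2) g = Some (x + x^-1).
  rewrite /theta_iter (addnS l 1) iterS -/(theta_iter (l + 1) g) Ex /=.
  by rewrite (negPf x0).
have [] := theta_unitary charF2 (n := n) b0 b1; first by rewrite -E2 -hq.
have -> : theta (Some (x + x^-1)) = theta_iter (l + 3) g.
  by rewrite -E2 /theta_iter (addnS l 2).
(* Again over F_(q^2), which now contains x by [xq]: Tr_2n(1/a) = 0 for a = x + 1/x. *)
rewrite tr_inv_addrV_fixed // => fx t1 t2.
split=> // i; rewrite addnS => il; rewrite (orbitP (l + 3)%N i g il).
by have := P1tr_orbit charF2 (i - (l + 3).+1) fx; rewrite t1 t2 add0r.
Qed.
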